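(* Let $G$ be an (additively written) abelian group. There is no subset $A\subseteq G$ with $|A|=5$ and $|A+A|>|A-A|$; that is, no MSTD set of size five exists in any additive abelian group.
   Context: For a finite subset $A$ of an additive abelian group, $A+A=\{a_1+a_2: a_1,a_2\in A\}$ and $A-A=\{a_1-a_2: a_1,a_2\in A\}$. The set $A$ is called a More Sums Than Differences (MSTD) set if $|A+A|>|A-A|$. The group $G$ may be finite or infinite. *)

(* Defs.v *)
From mathcomp Require Import all_boot all_order all_algebra finmap.

Set Implicit Arguments.
Unset Strict Implicit.
Unset Printing Implicit Defensive.

Local Open Scope fset_scope.

Definition sumset (G : zmodType) (A : {fset G}) : {fset G} :=
  [fset (a1 + a2)%R | a1 in A, a2 in A].

Definition diffset (G : zmodType) (A : {fset G}) : {fset G} :=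
  [fset (a1 - a2)%R | a1 in A, a2 in A].

Definition MSTD (G : zmodType) (A : {fset G}) : Prop :=
  (#|` diffset A| < #|` sumset A|)%N.

(* Main.v *)
Require Import Defs.
From mathcomp Require Import all_boot all_order all_algebra finmap.

Import GRing.Theory.

Set Implicit Arguments.
Unset Strict Implicit.
Unset Printing Implicit Defensive.

(** Every coincidence among the sums or differences of a_0, ..., a_4 is an
    integer relation c_0 a_0 + ... + c_4 a_4 = 0 with small coefficients.
    Branching on whether such a relation holds, one maintains the lattice
    spanned by the relations assumed to hold and a list of relations assumed
    to fail.  The lattice bounds |A+A| from above (sums congruent modulo the
    lattice are equal), the failing relations bound |A-A| from below, and a
    branch is closed as soon as these bounds give |A+A| <= |A-A|.  Up to
    relabelling, either a_0 + a_1 = a_2 + a_3, or this never happens and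
    a_1 + a_2 = 2 a_0, or no relation of these two shapes holds; in each case
    the search tree has fewer than a thousand nodes. *)

Section RelationSearch.

(** * Integer relations, lattice reduction and the search *)

Local Open Scope ring_scope.

(** Missing trailing entries count as zeros, so [[::]] serves as the zero vector. *)
Fixpoint lincomb (u : seq int) (q : int) (v : seq int) : seq int :=
  match u, v with
  | x :: u', y :: v' => (x + q * y) :: lincomb u' q v'
  | [::], _ => [seq q * y | y <- v]
  | _, [::] => u
  end.

(** [Some (b, u)] in position [i] stands for the relation with [i] leading
    zeros followed by [b :: u]; [None] means that there is no pivot [i]. *)
Definition echelon := seq (option (int * seq int)).

(** Remainders lie between 0 and |b| - 1, so vectors congruent modulo the lattice get the same
    normal form. *)
Fixpoint reduce (P : echelon) (v : seq int) : seq int :=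
  match P, v with
  | Some (b, u) :: P', x :: v' =>
      let q := (x %/ b)%Z in (x - q * b) :: reduce P' (lincomb v' (- q) u)
  | None :: P', x :: v' => x :: reduce P' v'
  | _, _ => v
  end.

(** When the fuel [n] runs out, the second relation is dropped, which is
    harmless for soundness. *)
Fixpoint euclid (n : nat) (b : int) (u : seq int) (x : int) (v : seq int) :=
  if n is n'.+1 then
    if x == 0 then (b, u, v)
    else let q := (b %/ x)%Z in euclid n' x v (b - q * x) (lincomb u (- q) v)
  else (b, u, [::]).

Fixpoint insert (v : seq int) (P : echelon) : echelon :=
  match P, v with
  | Some (b, u) :: P', x :: v' =>
      let: (b', u', w) := euclid 10 b u x v' in Some (b', u') :: insert w P'
  | None :: P', x :: v' =>
      if x == 0 then None :: insert v' P' else Some (x, v') :: P'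
  | _, _ => P
  end.

Definition unit_vectors : seq (seq int) :=
  [seq [seq (i == j)%:Z | j <- iota 0 5] | i <- iota 0 5].

Definition sum_vectors : seq (seq int) :=
  undup [seq lincomb u 1 v | u <- unit_vectors, v <- unit_vectors].

Definition diff_vectors : seq (seq int) :=
  undup [seq lincomb u (- 1) v | u <- unit_vectors, v <- unit_vectors].

Definition opp_vector (v : seq int) : seq int := lincomb [::] (- 1) v.

Definition apart (P : echelon) (N : seq (seq int)) (u v : seq int) : bool :=
  reduce P (lincomb u (- 1) v) \in N.

(** A greedy choice suffices: any family of pairwise distinct differences bounds |A-A| from
    below. *)
Definition separated (P : echelon) (N D : seq (seq int)) : seq (seq int) :=
  foldr (fun d L => if all (apart P N d) L then d :: L else L) [::] D.

Definition sum_classes (P : echelon) : seq (seq int) :=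
  undup [seq reduce P w | w <- sum_vectors].

Definition diff_classes (P : echelon) : seq (seq int) :=
  undup [seq reduce P w | w <- diff_vectors].

(** Candidates for branching: if [w] vanishes, two difference classes merge; if not, one more pair
    of classes is known to be apart. *)
Definition undecided (P : echelon) (N : seq (seq int)) : seq (seq int) :=
  let D := diff_classes P in
  [seq w <- [seq reduce P (lincomb d (- 1) l) | d <- D, l <- separated P N D]
  | (w != nseq 5 0) && (w \notin N)].

(** In the second branch the opposite of [w] joins [N] too, since [apart] tests a difference in one
    orientation only. *)
Fixpoint search (n : nat) (P : echelon) (N : seq (seq int)) : bool :=
  if (size (sum_classes P) <= size (separated P N (diff_classes P)))%N then true
  else if n is n'.+1 then
    if undecided P N is w :: _ then
      (let P' := insert w P in search n' P' (undup [seq reduce P' u | u <- N]))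
      && search n' P [:: w, reduce P (opp_vector w) & N]
    else false
  else false.

Definition search_from (v : seq int) (N : seq (seq int)) : bool :=
  let P := insert v (nseq 5 None) in
  search 40 P (undup [seq reduce P u | u <- N ++ map opp_vector N]).

(** The permutations of such a vector are all the relations of its shape, whatever the labelling. *)
Definition distinct2 : seq int := [:: 1; -1; 0; 0; 0].
Definition balanced4 : seq int := [:: 1; 1; -1; -1; 0].
Definition progression3 : seq int := [:: -2; 1; 1; 0; 0].

Lemma search_balanced4 : search_from balanced4 (permutations distinct2).
Proof. by vm_compute. Qed.

Lemma search_progression3 : search_from progression3
  (permutations distinct2 ++ permutations balanced4).
Proof. by vm_compute. Qed.

Lemma search_generic : search_from [::]
  (permutations distinct2 ++ permutations balanced4
   ++ permutations progression3).
Proof. by vm_compute. Qed.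

(** * Evaluation of relations in the group *)

Variable G : zmodType.
Implicit Types (s t : seq G) (v w : seq int) (P : echelon).

Definition eval v s : G := \sum_(p <- zip v s) p.2 *~ p.1.

Lemma eval_nil s : eval [::] s = 0.
Proof. by rewrite /eval; case: s => [|? ?]; rewrite big_nil. Qed.

Lemma eval_nilr v : eval v [::] = 0.
Proof. by rewrite /eval; case: v => [|? ?]; rewrite big_nil. Qed.

Lemma eval_cons x v a s : eval (x :: v) (a :: s) = a *~ x + eval v s.
Proof. by rewrite /eval /= big_cons. Qed.

Lemma eval_scale q v s : eval [seq q * y | y <- v] s = eval v s *~ q.
Proof.
elim: v s => [|y v IHv] [|a s]; rewrite ?eval_nil ?eval_nilr ?mul0rz //=.
by rewrite !eval_cons IHv mulrzDl mulrC mulrzA.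
Qed.

Lemma eval_lincomb u q v s : eval (lincomb u q v) s = eval u s + eval v s *~ q.
Proof.
elim: u v s => [|x u IHu] [|y v] s.
- by rewrite !eval_nil mul0rz addr0.
- by rewrite eval_scale eval_nil add0r.
- by rewrite [eval [::] s]eval_nil mul0rz addr0.
case: s => [|a s]; first by rewrite !eval_nilr mul0rz addr0.
by rewrite /= !eval_cons IHu mulrzDl mulrzDr mulrzA mulrzAC addrACA.
Qed.

Lemma eval_sub u v s : eval (lincomb u (- 1) v) s = eval u s - eval v s.
Proof. by rewrite eval_lincomb mulrN1z. Qed.

Lemma eval_opp v s : eval (opp_vector v) s = - eval v s.
Proof. by rewrite /opp_vector eval_sub eval_nil sub0r. Qed.

Fixpoint vanish P s : Prop :=
  match P, s with
  | Some (b, u) :: P', a :: s' => eval (b :: u) (a :: s') = 0 /\ vanish P' s'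
  | None :: P', _ :: s' => vanish P' s'
  | _, _ => True
  end.

Lemma vanish_nil k s : vanish (nseq k None) s.
Proof. by elim: k s => [|k IHk] [|a s] /=. Qed.

Lemma eval_reduce P v s : vanish P s -> eval (reduce P v) s = eval v s.
Proof.
elim: P v s => [|p P IHP] // v [|a s]; first by rewrite !eval_nilr.
case: p v => [[b u]|] [|x v] //=; last by move=> Ps; rewrite !eval_cons IHP.
case=> bu0 Ps; rewrite !eval_cons IHP // eval_lincomb.
(* Subtract from the right-hand side the vanishing pivot relation, taken [x %/ b] times. *)
rewrite -[RHS]subr0 -(mul0rz _ (x %/ b)%Z) -bu0 eval_cons mulrzDl -mulrzA.
by rewrite mulrzBr mulrNz opprD addrACA [b * _]mulrC.
Qed.

Lemma eval_euclid n b u x v a s :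
    eval (b :: u) (a :: s) = 0 -> eval (x :: v) (a :: s) = 0 ->
  let: (b', u', w) := euclid n b u x v in
  eval (b' :: u') (a :: s) = 0 /\ eval w s = 0.
Proof.
elim: n b u x v => [|n IHn] b u x v /= bu0 xv0; first by rewrite eval_nil.
case: eqP xv0 => [->|_] xv0; first by rewrite eval_cons mulr0z add0r in xv0.
apply: IHn => //.
have -> : (b - (b %/ x)%Z * x) :: lincomb u (- (b %/ x)%Z) v
        = lincomb (b :: u) (- (b %/ x)%Z) (x :: v) by rewrite /= mulNr.
by rewrite eval_lincomb bu0 xv0 mul0rz addr0.
Qed.

#[local] Arguments euclid : simpl never.

Lemma vanish_insert P v s : vanish P s -> eval v s = 0 -> vanish (insert v P) s.
Proof.
elim: P v s => [|p P IHP] // v s; case: p v => [[b u]|] [|x v] //.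
  case: s => [|a s]; first by move=> _ _ /=; case: euclid => [[? ?] ?].
  case=> bu0 Ps xv0; have /= := eval_euclid 10 bu0 xv0.
  by case: euclid => [[b' u'] w] [bu0' w0] /=; split; last exact: IHP.
case: s => [|a s] /=; first by case: eqP.
case: eqP => [->|_] /=; last by [].
by rewrite eval_cons mulr0z add0r; apply: IHP.
Qed.

Lemma eval_unit_vectors s :
  size s = 5 -> [seq eval u s | u <- unit_vectors] = s.
Proof.
case: s => [|a [|b [|c [|d [|e [|]]]]]] //= _.
by rewrite !eval_cons !eval_nil !mulr0z !mulr1z !add0r !addr0.
Qed.

(** As [f] need not be injective, the permutation is lifted through positions. *)
Lemma perm_map_lift (T U : eqType) (f : T -> U) (s : seq T) (r : seq U) :
  perm_eq r (map f s) -> exists2 t, perm_eq t s & map f t = r.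
Proof.
case: s => [|x s]; first by move/perm_nilP->; exists [::].
case/(perm_iotaP (f x)) => Is; rewrite size_map => Is_iota ->.
exists [seq nth x (x :: s) i | i <- Is].
  by apply/(perm_iotaP x); exists Is.
rewrite -map_comp; apply/eq_in_map => i.
rewrite (perm_mem Is_iota) mem_iota => /andP[_ i_lt].
by rewrite (nth_map x).
Qed.

(** The value depends only on the multiset of pairs (coefficient, element), so permuting
    coefficients amounts to reordering elements. *)
Lemma eval_permutations v s w :
    size v = size s -> w \in permutations v ->
  exists2 t, perm_eq t s & eval w s = eval v t.
Proof.
move=> sz_v; rewrite mem_permutations perm_sym => vw.
have sz_w : size w = size s by rewrite -(perm_size vw).
have [r r_zip r1] : exists2 r, perm_eq r (zip w s) & unzip1 r = v.
  by apply: perm_map_lift; rewrite -/(unzip1 _) unzip1_zip ?sz_w.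
exists (unzip2 r).
  by rewrite (permPl (perm_map _ r_zip)) -/(unzip2 _) unzip2_zip ?sz_w.
by rewrite /eval -r1 zip_unzip (perm_big _ r_zip).
Qed.

(** * Cardinality bounds and soundness of the search *)

Local Open Scope fset_scope.

Variables (A : {fset G}) (s : seq G).
Hypotheses (sA : s =i A) (s5 : size s = 5).

Lemma mem_unit_vectors a :
  reflect (exists2 u, u \in unit_vectors & a = eval u s) (a \in A).
Proof. by rewrite -sA -[s in _ \in s](eval_unit_vectors s5); apply: mapP. Qed.

Lemma eval_sum_vectors x :
  x \in sumset A -> x \in [seq eval w s | w <- sum_vectors].
Proof.
case/imfset2P=> _ /mem_unit_vectors[u Eu ->] [_ /mem_unit_vectors[v Ev ->] ->].
apply/mapP; exists (lincomb u 1 v); last by rewrite eval_lincomb mulr1z.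
by rewrite mem_undup; apply/allpairsP; exists (u, v).
Qed.

Lemma eval_diff_vectors w : w \in diff_vectors -> eval w s \in diffset A.
Proof.
rewrite mem_undup => /allpairsP[[u v] /= [Eu Ev ->]]; rewrite eval_sub.
apply/imfset2P; exists (eval u s); first by apply/mem_unit_vectors; exists u.
by exists (eval v s) => //; apply/mem_unit_vectors; exists v.
Qed.

Lemma separated_subset P N D : {subset separated P N D <= D}.
Proof.
elim: D => [|d D IHD] //= w; case: ifP => _; rewrite !inE.
  by case/predU1P=> [->|/IHD->]; rewrite ?eqxx ?orbT.
by move/IHD->; rewrite orbT.
Qed.

Lemma separated_uniq P N D :
    vanish P s -> {in N, forall w, eval w s != 0} ->
  uniq [seq eval w s | w <- separated P N D].
Proof.
move=> Ps N0; elim: D => [|d D IHD] //=; case: ifP => //= /allP dL.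
rewrite IHD andbT; apply/mapP => -[l /dL /N0].
by rewrite eval_reduce // eval_sub subr_eq0 => /eqP.
Qed.

Lemma card_sumset_le P :
  vanish P s -> (#|` sumset A| <= size (sum_classes P))%N.
Proof.
move=> Ps; rewrite -(size_map (eval^~ s)).
apply: uniq_leq_size (fset_uniq _) _ => x /eval_sum_vectors /mapP[w Ew ->].
by rewrite -(eval_reduce w Ps) (map_f (eval^~ s)) // mem_undup map_f.
Qed.

Lemma card_diffset_ge P N :
    vanish P s -> {in N, forall w, eval w s != 0} ->
  (size (separated P N (diff_classes P)) <= #|` diffset A|)%N.
Proof.
move=> Ps N0; rewrite -(size_map (eval^~ s)).
apply: uniq_leq_size (separated_uniq _ Ps N0) _ => _ /mapP[w Lw ->].
have:= separated_subset Lw; rewrite mem_undup => /mapP[d Dd ->].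
by rewrite eval_reduce // eval_diff_vectors.
Qed.

#[local] Arguments sum_classes : simpl never.
#[local] Arguments diff_classes : simpl never.
#[local] Arguments undecided : simpl never.

Lemma search_sound n P N :
    vanish P s -> {in N, forall w, eval w s != 0} -> search n P N ->
  (#|` sumset A| <= #|` diffset A|)%N.
Proof.
elim: n P N => [|n IHn] P N Ps N0 /=.
  case: ifP => [/(leq_trans (card_sumset_le Ps)) le_AL _|_]; last by [].
  exact: leq_trans le_AL (card_diffset_ge Ps N0).
case: ifP => [/(leq_trans (card_sumset_le Ps)) le_AL _|_].
  exact: leq_trans le_AL (card_diffset_ge Ps N0).
case: undecided => [|w _ /andP[search1 search2]]; first by [].
(* Whichever alternative is true at [s], the matching recursive call keeps both invariants. *)
have [w0|w0] := eqVneq (eval w s) 0.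
  have P's := vanish_insert Ps w0; apply: (IHn _ _ P's) search1 => u.
  by rewrite mem_undup => /mapP[v Nv ->]; rewrite eval_reduce // N0.
apply: IHn search2 => // u; rewrite !inE => /or3P[/eqP->|/eqP->|/N0] //.
by rewrite eval_reduce // eval_opp oppr_eq0.
Qed.

Lemma search_from_sound v N :
    eval v s = 0 -> {in N, forall w, eval w s != 0} -> search_from v N ->
  (#|` sumset A| <= #|` diffset A|)%N.
Proof.
move=> v0 N0; have Ps := vanish_insert (vanish_nil 5 s) v0.
apply: search_sound => // u; rewrite mem_undup => /mapP[w + ->].
rewrite eval_reduce // mem_cat => /orP[/N0 //|/mapP[{}w Nw ->]].
by rewrite eval_opp oppr_eq0 N0.
Qed.

End RelationSearch.

(** * The three cases for a set of size five *)

Local Open Scope fset_scope.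

Lemma sumset_le_diffset (G : zmodType) (A : {fset G}) :
  #|` A| = 5 -> (#|` sumset A| <= #|` diffset A|)%N.
Proof.
(* Quantifying over the orderings of [A] handles relabelling: a witness ordering serves as a_0, ...,
   a_4. *)
move=> A5; pose holds v := has (fun t => eval v t == 0%R) (permutations A).
have holdsN v : size v = 5 -> ~~ holds v ->
    forall t, perm_eq t A -> {in permutations v, forall w, eval w t != 0%R}.
  move=> v5 /hasPn v0 t tA w.
  have v_t : size v = size t by rewrite (perm_size tA) A5.
  case/(eval_permutations v_t) => r rt ->.
  by rewrite v0 // mem_permutations (permPl rt).
have holdsP v : holds v -> exists2 t, perm_eq t A & eval v t = 0%R.
  by case/hasP=> t; rewrite mem_permutations => tA /eqP; exists t.
have distinct_t : ~~ holds distinct2.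
  apply/hasPn => t; rewrite mem_permutations => tA.
  have := fset_uniq A; rewrite -(perm_uniq tA).
  have := perm_size tA; rewrite A5.
  case: t {tA} => [|a [|b [|c [|d [|e [|]]]]]] //= _ /andP[+ _].
  rewrite !inE !negb_or => /andP[+ _].
  by rewrite !eval_cons eval_nil !mulr0z mulr1z mulrN1z !addr0 subr_eq0.
have [/holdsP[t tA t0] | bal] := boolP (holds balanced4).
  apply: (search_from_sound (perm_mem tA) _ t0 _ search_balanced4).
    by rewrite (perm_size tA).
  exact: holdsN.
have [/holdsP[t tA t0] | prog] := boolP (holds progression3).
  apply: (search_from_sound (perm_mem tA) _ t0 _ search_progression3).
    by rewrite (perm_size tA).
  by move=> w; rewrite mem_cat => /orP[]; apply: holdsN.
(* Any ordering of [A] will do here, and the zero relation [[::]] leaves the lattice trivial. *)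
apply: (search_from_sound _ _ _ _ search_generic) => //; first exact: eval_nil.
by move=> w; rewrite !mem_cat => /or3P[]; apply: holdsN.
Qed.

Theorem theorem1p1 (G : zmodType) :
  ~ exists A : {fset G}, #|` A| = 5 /\ MSTD A.
Proof. by case=> A [A5]; rewrite /MSTD ltnNge sumset_le_diffset. Qed.
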